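(* Let $V$ be a real inner product space of finite dimension $n\ge 1$ with a fixed ordered orthonormal basis $(e_1,\ldots,e_n)$, and let $\det: V^n\to\mathbb{R}$ be the geometric determinant, i.e. $\det(v_1,\ldots,v_n)=S(v_1,\ldots,v_n)\,\mathrm{vol}(v_1,\ldots,v_n)$ if $(v_1,\ldots,v_n)$ is a basis of $V$, and $\det(v_1,\ldots,v_n)=0$ otherwise, where $S$ is the geometric orientation with respect to $(e_1,\ldots,e_n)$ and $\mathrm{vol}$ is the volume of the parallelepiped, both as defined in the context. Then $\det$ is multilinear and alternating.
   Context: $V$ is a real inner product space of dimension $n$, with inner product $u\cdot v$, norm $|\cdot|$, and a fixed ordered orthonormal basis $(e_1,\ldots,e_n)$. Rotations. For noncollinear unit vectors $u,w$, put $\widehat{u}=\dfrac{u-(w\cdot u)w}{|u-(w\cdot u)w|}$ and, for $t\in\mathbb{R}$, $v\in V$, $$R_{u,w}^t v = v-(\widehat u\cdot v)\widehat u-(w\cdot v)w+(\cos(t)(\widehat u\cdot v)-\sin(t)(w\cdot v))\widehat u+(\sin(t)(\widehat u\cdot v)+\cos(t)(w\cdot v))w,$$ and $T_{u,w}=\dfrac{\widehat u\cdot u}{|\widehat u\cdot u|}\arccos(w\cdot u)$. One has $R_{u,w}^0v=v$ and $R_{u,w}^{T_{u,w}}u=w$. Orientation of orthonormal bases. The orientation $S_n(u_1,\ldots,u_n)\in\{1,-1\}$ of an ordered orthonormal basis $(u_1,\ldots,u_n)$ with respect to $(e_1,\ldots,e_n)$ is defined inductively on $n$: (n=1) $S_1(u_1)=1$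 if $u_1=e_1$ and $S_1(u_1)=-1$ if $u_1=-e_1$. (n=2) For $k=1,2$ let $c_k(t)=(\cos(t)(e_1\cdot u_k)-\sin(t)(e_2\cdot u_k))e_1+(\sin(t)(e_1\cdot u_k)+\cos(t)(e_2\cdot u_k))e_2$, and $T_2=\dfrac{e_1\cdot u_2}{|e_1\cdot u_2|}\arccos(e_2\cdot u_2)$ (if $e_1\cdot u_2=0$, the sign factor may be taken to be $1$ or $-1$; this does not affect the outcome). Then $c_2(T_2)=e_2$ and $c_1(T_2)=\pm e_1$; set $S_2(u_1,u_2)=1$ if $c_1(T_2)=e_1$ and $-1$ if $c_1(T_2)=-e_1$. (n≥3) If $u_n\ne\pm e_n$, set $S_n(u_1,\ldots,u_n)=S_{n-1}(R_{u_n,e_n}^{T_n}u_1,\ldots,R_{u_n,e_n}^{T_n}u_{n-1})$ with $T_n=T_{u_n,e_n}$, where the orthonormal vectors on the right form an ordered orthonormal basis of the span of $(e_1,\ldots,e_{n-1})$ and $S_{n-1}$ is the orientation with respect to $(e_1,\ldots,e_{n-1})$. If $u_n=\pm e_n$, $S_n(u_1,\ldots,u_n)$ is defined as the common value of $S_n(u_1',\ldots,u_n')$ for all ordered orthonormal bases $(u_1',\ldots,u_n')$ sufficiently close to $(u_1,\ldots,u_n)$ with $u_n'\ne\pm e_n$ (this is well defined). Orientation of general bases. For an ordered basis $(v_1,\ldots,v_n)$ of $V$, $S(v_1,\ldots,v_n)=S_n(G(v_1,\ldots,v_n))$, where $G(v_1,\ldots,v_n)=(u_1,\ldots,u_n)$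 is the Gram–Schmidt orthonormalization: $u_1=v_1/|v_1|$, $u_i=\dfrac{v_i-\sum_{j<i}(v_i\cdot u_j)u_j}{|v_i-\sum_{j<i}(v_i\cdot u_j)u_j|}$. Volume. $P(v_1,\ldots,v_n)=\{t_1v_1+\cdots+t_nv_n: t_1,\ldots,t_n\in[0,1)\}$ and $\mathrm{vol}(v_1,\ldots,v_n)=\mu(P(v_1,\ldots,v_n))$, where $\mu$ is the unique translation-invariant (Borel) measure on $V$ with $\mu(P(e_1,\ldots,e_n))=1$. Alternating means that interchanging two arguments changes the sign (equivalently, over $\mathbb{R}$, the multilinear map vanishes when two arguments are equal). *)

(* Defs.v *)
From HB Require Import structures.
From mathcomp Require Import all_boot all_order all_algebra fingroup perm.
From mathcomp Require Import all_classical all_reals all_analysis.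
Set Implicit Arguments.
Unset Strict Implicit.
Unset Printing Implicit Defensive.
Import Order.TTheory GRing.Theory Num.Theory.
Local Open Scope classical_set_scope.
Local Open Scope ring_scope.

(* Measurable types must be pointed, and an arbitrary zmodType is not. *)
Definition pointed_zmod (V : zmodType) : Type := V.
HB.instance Definition _ (V : zmodType) := Choice.on (pointed_zmod V).
HB.instance Definition _ (V : zmodType) := isPointed.Build (pointed_zmod V) (0 : V).

Section Geometry.
Context {R : realType} {V : vectType R} (dot : {dot V for idfun}).
Implicit Types (u v w p : V) (t : R).

Definition dnorm v : R := Num.sqrt (dot v v).

Definition unitv v : V := (dnorm v)^-1 *: v.

(* Rotation by the angle t of the component of v in the plane of the
   orthonormal vectors p and w. *)
Definition plane_rotation p w t v : V :=
  (cos t * dot p v - sin t * dot w v) *: p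
  + (sin t * dot p v + cos t * dot w v) *: w.

(* The unit vector written u with a circumflex; it depends on u and w. *)
Definition hat u w : V := unitv (u - dot w u *: w).

Definition rotation u w t v : V :=
  v - dot (hat u w) v *: hat u w - dot w v *: w
  + plane_rotation (hat u w) w t v.

Definition rotation_angle u w : R :=
  dot (hat u w) u / `|dot (hat u w) u| * acos (dot w u).

Definition orthonormal_basis_of n (U : {vspace V}) (u : 'I_n -> V) : bool :=
  orthonormal dot (mktuple u) && basis_of U (mktuple u).

Definition orientation1 (e u : 'I_1 -> V) : R :=
  if u ord0 == e ord0 then 1 else - 1.

(* The sign in front of the arccosine is taken to be 1 when e_1 . u_2 = 0;
   the library's x / `|x| would be 0 there. *)
Definition orientation2 (e u : 'I_2 -> V) : R :=
  let x := dot (e ord0) (u ord_max) in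
  let T := (if x == 0 then 1 else x / `|x|)
           * acos (dot (e ord_max) (u ord_max)) in
  if plane_rotation (e ord0) (e ord_max) T (u ord0) == e ord0 then 1 else - 1.

Definition collinear_last n (e u : 'I_n.+1 -> V) : bool :=
  (u ord_max == e ord_max) || (u ord_max == - e ord_max).

(* In the case u_n = e_n or u_n = - e_n, the set below is the singleton of the
   common value near u, and xget extracts it; the default 0 is not
   an orientation. *)
Definition orientation_step n (S : ('I_n -> V) -> ('I_n -> V) -> R)
    (e u : 'I_n.+1 -> V) : R :=
  let generic (u' : 'I_n.+1 -> V) :=
    let T := rotation_angle (u' ord_max) (e ord_max) in
    S (fun i => e (lift ord_max i))
      (fun i => rotation (u' ord_max) (e ord_max) T (u' (lift ord_max i))) in
  if collinear_last e u then
    xget 0 [set s | exists2 eps : R, 0 < eps &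
      forall u' : 'I_n.+1 -> V,
        orthonormal_basis_of <<mktuple e>>%VS u' ->
        (forall i, dnorm (u' i - u i) < eps) ->
        ~~ collinear_last e u' -> generic u' = s]
  else generic u.

Fixpoint orientation_onb (n : nat) : ('I_n -> V) -> ('I_n -> V) -> R :=
  match n with
  | 0 => fun _ _ => 1
  | m.+1 =>
    match m return (('I_m -> V) -> ('I_m -> V) -> R) ->
                   ('I_m.+1 -> V) -> ('I_m.+1 -> V) -> R with
    | 0 => fun _ => orientation1
    | 1 => fun _ => orientation2
    | _.+2 => @orientation_step _
    end (@orientation_onb m)
  end.

Definition gram_schmidt_seq (vs : seq V) : seq V :=
  foldl (fun us v => rcons us (unitv (v - \sum_(u <- us) dot v u *: u)))
    [::] vs.

Definition gram_schmidt n (v : 'I_n -> V) : 'I_n -> V :=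
  fun i => (gram_schmidt_seq (mktuple v))`_i.

Definition orientation n (e v : 'I_n -> V) : R :=
  orientation_onb e (gram_schmidt v).

Definition parallelepiped n (v : 'I_n -> V) : set V :=
  [set x | exists2 t : 'I_n -> R,
     (forall i, 0 <= t i < 1) & x = \sum_i t i *: v i].

(* Open sets of V for the norm dnorm. *)
Definition dopen : set (set (pointed_zmod V)) :=
  [set A | forall x : V, A x -> exists2 eps : R, 0 < eps &
     forall y : V, dnorm (y - x) < eps -> A y].

Definition borelV := g_sigma_algebraType dopen.

Definition translation_invariant (mu : set borelV -> \bar R) : Prop :=
  forall (x : V) (A : set borelV), measurable A ->
    mu [set (x + (y : V) : V) | y in A] = mu A.

Definition geometric_det (mu : set borelV -> \bar R) n (e v : 'I_n -> V) : R :=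
  if basis_of fullv (mktuple v)
  then orientation e v * fine (mu (parallelepiped v))
  else 0.

Definition multilinear_map n (f : ('I_n -> V) -> R) : Prop :=
  forall (v : 'I_n -> V) (i : 'I_n),
    scalar (fun x : V => f (@dfwith _ (fun=> V) v i x)).

Definition alternating_map n (f : ('I_n -> V) -> R) : Prop :=
  forall (v : 'I_n -> V) (i j : 'I_n), i != j ->
    f (fun k => v (tperm i j k)) = - f v.

End Geometry.

Arguments geometric_det {R V} dot mu {n} e v.
Arguments translation_invariant {R V} dot mu.

(* Main.v *)
Require Import Defs.
From mathcomp Require Import all_boot all_order all_algebra perm ring lra.
From mathcomp Require Import all_classical all_reals all_analysis.
Set Implicit Arguments.
Unset Strict Implicit.
Unset Printing Implicit Defensive.
Import Order.TTheory GRing.Theory Num.Theory.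
Local Open Scope classical_set_scope.
Local Open Scope ring_scope.

(* The geometric determinant of v is the determinant D(v) of the matrix of inner
   products e_i . v_j. For an orthonormal family the orientation equals D:
   each rotation in the recursion has determinant 1, being the square of the
   rotation by half the angle, and D is constant near a given orthonormal
   family because an orthogonal matrix of determinant -1 has -1 as an
   eigenvalue and so is not close to 1. Gram-Schmidt multiplies D by a positive
   factor. The volume of the parallelepiped is |D|: both sides scale by |c| when
   a vector is multiplied by c, are unchanged when one vector is added to
   another or two are swapped, and these operations lead from e to any basis. *)

(** * Orthonormal families *)

(** The measure is never compared with Lebesgue measure: the volume part rests on translation
    invariance, additivity and monotonicity of [mu], and on the value at the cube of [e]. Finiteness
    of volumes is not assumed; it is carried along with the formula from [e] to the other bases.
    Scaling by a real factor comes from Cauchy's functional equation, which translation invariance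
    provides and monotonicity makes linear. A change of sign or a shear does not respect half-open
    cubes, so these operations are handled by cutting and translating pieces. On the orientation
    side the delicate clause is the one for [u_n = e_n] or [u_n = - e_n]. Its value is defined by a
    condition on nearby families, so two facts are needed: the generic value is constant close to
    [u], and noncollinear families occur arbitrarily close to [u]. *)

Section InnerProduct.
Context {R : realType} {V : vectType R} (dot : {dot V for idfun}).
Implicit Types (u v w p x y : V) (a t : R).

Lemma dotC u v : dot u v = dot v u.
Proof. by rewrite hermC mul1r. Qed.

Lemma dotDr u v w : dot u (v + w) = dot u v + dot u w.
Proof. exact: linearDr. Qed.
Lemma dotDl u v w : dot (v + w) u = dot v u + dot w u.
Proof. exact: linearDl. Qed.
Lemma dotNr u v : dot u (- v) = - dot u v.
Proof. exact: linearNr. Qed.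
Lemma dotNl u v : dot (- v) u = - dot v u.
Proof. exact: linearNl. Qed.
Lemma dotZr a u v : dot u (a *: v) = a * dot u v.
Proof. exact: linearZr_LR. Qed.
Lemma dotZl a u v : dot (a *: v) u = a * dot v u.
Proof. exact: linearZl_LR. Qed.
Lemma dot0r u : dot u 0 = 0.
Proof. exact: linear0r. Qed.
Lemma dot_sumr (I : Type) (r : seq I) (P : pred I) (F : I -> V) u :
  dot u (\sum_(i <- r | P i) F i) = \sum_(i <- r | P i) dot u (F i).
Proof. exact: linear_sumr. Qed.
Lemma dot_suml (I : Type) (r : seq I) (P : pred I) (F : I -> V) u :
  dot (\sum_(i <- r | P i) F i) u = \sum_(i <- r | P i) dot (F i) u.
Proof. exact: linear_sumlz. Qed.

Definition dotE := (dotDr, dotDl, dotNr, dotNl, dotZr, dotZl).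

Lemma dot_gt0 u : (0 < dot u u) = (u != 0).
Proof.
have [->|u0] := eqVneq u 0; first by rewrite dot0r ltxx.
exact: neq0_dnorm_gt0.
Qed.

Lemma dot_ge0 u : 0 <= dot u u.
Proof.
have [->|u0] := eqVneq u 0; first by rewrite dot0r.
by rewrite ltW // dot_gt0.
Qed.

Lemma sqr_dnorm u : dnorm dot u ^+ 2 = dot u u.
Proof. by rewrite sqr_sqrtr // dot_ge0. Qed.

Lemma dnorm_pos u : (0 < dnorm dot u) = (u != 0).
Proof. by rewrite sqrtr_gt0 dot_gt0. Qed.

Lemma dot_unitv u : u != 0 -> dot (unitv dot u) (unitv dot u) = 1.
Proof.
move=> u0; rewrite /unitv !dotE mulrA -sqr_dnorm -expr2 exprVn mulVf ?expf_neq0 //.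
by rewrite gt_eqF // dnorm_pos.
Qed.

(** Cauchy-Schwarz for a unit vector: the residual [x - dot u x *: u] has nonnegative square. *)
Lemma dot_unit_le u x : dot u u = 1 -> `|dot u x| <= dnorm dot x.
Proof.
move=> u1; rewrite -[leLHS]sqrtr_sqr ler_wsqrtr //.
have := dot_ge0 (x - dot u x *: u).
by rewrite !dotE u1 (dotC x u) => h; lra.
Qed.

Definition dot_mx n (e u : 'I_n -> V) : 'M[R]_n := \matrix_(i, j) dot (e i) (u j).

Definition orthonormal_fam n (u : 'I_n -> V) :=
  forall i j, dot (u i) (u j) = (i == j)%:R.

Lemma orthonormal_famP n (u : 'I_n -> V) :
  reflect (orthonormal_fam u) (orthonormal dot (mktuple u)).
Proof.
have pairE s : pair_ortho_rec dot s = pairwise (fun u v => dot u v == 0) s.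
  by elim: s => //= a s ->; rewrite /ortho_rec /= andbT.
rewrite /orthonormal pairE; apply: (iffP andP) => [[/allP u1 /(pairwiseP 0) up] i j|ou].
  have nt (k : 'I_n) : (mktuple u)`_k = u k by rewrite -tnth_nth tnth_mktuple.
  have [<-|ij] := eqVneq i j; first by apply/eqP/u1; rewrite map_f ?mem_enum.
  wlog lij : i j ij / (i < j)%N => [hw|].
    case: (ltngtP i j) => [/hw|/hw|/ord_inj/eqP]; first exact.
      by rewrite dotC eq_sym; apply.
    by rewrite (negPf ij).
  by have := up i j; rewrite !inE !size_tuple !ltn_ord !nt => /(_ isT isT lij)/eqP.
split; first by apply/allP => x /mapP[i _ ->] /=; rewrite ou eqxx.
apply/(pairwiseP 0) => i j; rewrite !inE !size_tuple => lin ljn lij.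
rewrite (_ : i = Ordinal lin) // (_ : j = Ordinal ljn) // -!tnth_nth !tnth_mktuple ou.
by rewrite -val_eqE /= ltn_eqF.
Qed.

Lemma orthonormal_fam_expand n (e : 'I_n -> V) x : orthonormal_fam e ->
  x \in <<mktuple e>>%VS -> x = \sum_i dot (e i) x *: e i.
Proof.
move=> oe /coord_span ex; rewrite {1}ex; apply: eq_bigr => i _.
rewrite -tnth_nth tnth_mktuple; congr (_ *: _).
rewrite [in RHS]ex dot_sumr (bigD1 i) // big1 => [|j /andP[_ ji]].
  by rewrite -tnth_nth tnth_mktuple dotZr oe eqxx mulr1 /= addr0.
by rewrite -tnth_nth tnth_mktuple dotZr oe eq_sym (negPf ji) mulr0.
Qed.

Lemma orthonormal_fam_free n (e : 'I_n -> V) : orthonormal_fam e -> free (mktuple e).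
Proof.
move=> oe; apply/freeP => k k0 i.
have := congr1 (dot (e i)) k0; rewrite dot0r dot_sumr (bigD1 i) // big1 => [|j /andP[_ ji]].
  by rewrite -tnth_nth tnth_mktuple dotZr oe eqxx mulr1 /= addr0.
by rewrite -tnth_nth tnth_mktuple dotZr oe eq_sym (negPf ji) mulr0.
Qed.

Lemma mem_span_fam n (e : 'I_n -> V) i : e i \in <<mktuple e>>%VS.
Proof. by apply: memv_span; rewrite map_f ?mem_enum. Qed.

Lemma span_famS n (e : 'I_n -> V) (U : {vspace V}) :
  (forall i, e i \in U) -> (<<mktuple e>> <= U)%VS.
Proof. by move=> eU; apply/span_subvP => x /mapP[i _ ->]. Qed.

(** Orthonormal families are free, so counting dimensions turns the inclusion of spans into
    equality. *)
Lemma orthonormal_basis_ofP n (e u : 'I_n -> V) : orthonormal_fam e ->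
  reflect (orthonormal_fam u /\ forall j, u j \in <<mktuple e>>%VS)
    (orthonormal_basis_of dot <<mktuple e>> u).
Proof.
move=> oe; apply: (iffP andP) => [[/orthonormal_famP ou bu]|[ou ue]].
  by split=> // j; apply: (basis_mem bu); rewrite map_f ?mem_enum.
split; first exact/orthonormal_famP.
rewrite basisEfree orthonormal_fam_free // span_famS //=.
by rewrite size_tuple (leq_trans (dim_span _)) // size_tuple.
Qed.

Lemma tr_dot_mx n (e u : 'I_n -> V) : (dot_mx e u)^T = dot_mx u e.
Proof. by apply/matrixP => i j; rewrite !mxE dotC. Qed.

(** Expanding [u j] in [e] inserts the identity between [a] and [u]. This cocycle rule carries every
    later change of family. *)
Lemma dot_mx_mul n (a e u : 'I_n -> V) : orthonormal_fam e ->
  (forall j, u j \in <<mktuple e>>%VS) -> dot_mx a e *m dot_mx e u = dot_mx a u.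
Proof.
move=> oe ue; apply/matrixP => i j; rewrite !mxE.
rewrite [in RHS](orthonormal_fam_expand oe (ue j)) dot_sumr.
by apply: eq_bigr => k _; rewrite !mxE dotZr mulrC.
Qed.

Lemma dot_mx_orthonormal n (u : 'I_n -> V) : orthonormal_fam u -> dot_mx u u = 1%:M.
Proof. by move=> ou; apply/matrixP => i j; rewrite !mxE ou. Qed.

Lemma det_dot_mx_sqr n (e u : 'I_n -> V) : orthonormal_fam e -> orthonormal_fam u ->
  (forall j, u j \in <<mktuple e>>%VS) -> \det (dot_mx e u) ^+ 2 = 1.
Proof.
move=> oe ou ue.
by rewrite expr2 -{1}det_tr -det_mulmx tr_dot_mx dot_mx_mul // dot_mx_orthonormal // det1.
Qed.

Lemma det_dot_mx_near n (e u u' : 'I_n -> V) :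
  orthonormal_fam e -> orthonormal_fam u -> orthonormal_fam u' ->
  (forall j, u j \in <<mktuple e>>%VS) -> (forall j, u' j \in <<mktuple e>>%VS) ->
  (forall j, dnorm dot (u' j - u j) < n.+1%:R^-1) ->
  \det (dot_mx e u') = \det (dot_mx e u).
Proof.
move=> oe ou ou' ue u'e near.
have GE : \det (dot_mx u u') = \det (dot_mx e u) * \det (dot_mx e u').
  by rewrite -[X in X * _]det_tr -det_mulmx tr_dot_mx dot_mx_mul.
have uu' j : u' j \in <<mktuple u>>%VS.
  rewrite (_ : <<mktuple u>> = <<mktuple e>>)%VS //; apply/eqP.
  rewrite eqEdim span_famS //=.
  by move: (orthonormal_fam_free ou) (orthonormal_fam_free oe);
    rewrite /free !size_tuple => /eqP -> /eqP ->.
set G := dot_mx u u' in GE *.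
have GG : G^T *m G = 1%:M by rewrite tr_dot_mx dot_mx_mul // dot_mx_orthonormal.
(* For a row [r] in the kernel, look at its largest entry [r i]. The kernel equation gives [2 * r i]
   as a sum of [n] terms, each at most [|r i| / (n + 1)] in absolute value, which is too small. *)
have: \det (G + 1%:M) != 0.
  apply/det0P => -[r r0 rG].
  have [i rmax] : exists i, forall j, `|r 0 j| <= `|r 0 i|.
    have /rV0Pn[i ri] := r0.
    case: (@arg_maxP _ _ _ i predT (fun j => `|r 0 j|) isT) => k _ kmax.
    by exists k => j; apply: kmax.
  have ri : 0 < `|r 0 i|.
    rewrite normr_gt0; apply: contraNneq r0 => ri0; apply/eqP/rowP => j; rewrite mxE.
    by apply/eqP; rewrite -normr_le0; have := rmax j; rewrite ri0 normr0.
  have := congr1 (fun M : 'rV_n => M 0 i) rG; rewrite !mxE => h.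
  have : 2 * r 0 i = - \sum_j r 0 j * dot (u j) (u' i - u i).
    have E j : r 0 j * (G + 1%:M) j i =
        r 0 j * dot (u j) (u' i - u i) + (if j == i then 2 * r 0 j else 0).
      by rewrite !mxE !dotE ou; case: eqVneq => _ /=; ring.
    move: h; rewrite (eq_bigr _ (fun j _ => E j)) big_split /= -big_mkcond big_pred1_eq.
    by move=> h; lra.
  move/(congr1 Num.norm); rewrite normrN normrM ger0_norm // => h2.
  have : 2 * `|r 0 i| <= \sum_(j < n) `|r 0 i| * n.+1%:R^-1.
    rewrite h2 (le_trans (ler_norm_sum _ _ _)) // ler_sum // => j _.
    rewrite normrM ler_pM // (le_trans (dot_unit_le _ _)) ?ou ?eqxx //.
    exact: ltW.
  rewrite sumr_const card_ord -[_ *+ n]mulr_natr -mulrA [leLHS]mulrC .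
  rewrite ler_pM2l // => {}h.
  have : n.+1%:R^-1 * n%:R <= 1 :> R.
    by rewrite mulrC ler_pdivrMr ?ltr0n // mul1r ler_nat.
  by move=> /(le_trans h); lra.
(* As [G] is orthogonal, [G + 1 = G (1 + G^T)]; the nonzero factor then cancels and leaves
   [\det G = 1]. *)
have dG : \det (G + 1%:M) = \det G * \det (G + 1%:M).
  by rewrite -[X in _ = _ * X]det_tr -det_mulmx linearD /= tr_scalar_mx mulmxDr mulmx1
    (mulmx1C GG) addrC.
move=> G1; have {dG}G1 : \det G = 1.
  by apply: (mulIf G1); rewrite mul1r.
have d1 := det_dot_mx_sqr oe ou ue.
by rewrite -[RHS]mulr1 -G1 GE mulrA -expr2 d1 mul1r.
Qed.

End InnerProduct.

(** * Rotations *)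

(** The angle [t] is the polar angle of the point [(b, a)] of the unit circle. When [a = 0] the sine
    of the arccosine is 0, so either sign would do. *)
Lemma cos_sin_arccos (R : realType) (a b : R) : a ^+ 2 + b ^+ 2 = 1 ->
  let t := (if a == 0 then 1 else a / `|a|) * acos b in cos t = b /\ sin t = a.
Proof.
move=> ab1.
have b1 : -1 <= b <= 1.
  by rewrite -ler_norml -(@expr_le1 _ 2) // real_normK ?num_real //; nra.
have cb : cos (acos b) = b by rewrite acosK // in_itv.
have sb : sin (acos b) = `|a|.
  by rewrite sin_acos // (_ : 1 - b ^+ 2 = a ^+ 2) ?sqrtr_sqr // -ab1 addrK.
case: (ltgtP a 0) => [a0|a0|a0] /=.
- by rewrite ltr0_norm // invrN mulrN divff ?ltr0_neq0 // mulN1r cosN sinN cb sb ltr0_norm // opprK.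
- by rewrite gtr0_norm // divff ?gt_eqF // mul1r cb sb gtr0_norm.
- by rewrite mul1r cb sb a0 normr0.
Qed.

Section Rotation.
Context {R : realType} {V : vectType R} (dot : {dot V for idfun}).
Implicit Types (u v w p x y : V) (a t : R).

(** [rotation] with [hat u w] freed to an arbitrary [p], so that the plane and the angle can be
    chosen independently of [u]. *)
Definition plane_rot p w t v : V :=
  v - dot p v *: p - dot w v *: w + plane_rotation dot p w t v.

Lemma cos2_sin2 t : cos t ^+ 2 = 1 - sin t ^+ 2.
Proof. by rewrite -(cos2Dsin2 t) addrK. Qed.

Section OrthonormalPair.
Variables (p w : V).
Hypotheses (pp : dot p p = 1) (ww : dot w w = 1) (pw : dot p w = 0).

Lemma dot_plane_rot t x y : dot y (plane_rot p w t x) =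
  dot y x - dot p x * dot p y - dot w x * dot w y
  + (cos t * dot p x - sin t * dot w x) * dot p y
  + (sin t * dot p x + cos t * dot w x) * dot w y.
Proof. by rewrite /plane_rot /plane_rotation !dotE !(dotC dot y) addrA. Qed.

Lemma dot_plane_rot_p t x : dot p (plane_rot p w t x) = cos t * dot p x - sin t * dot w x.
Proof. by rewrite dot_plane_rot pp (dotC dot w p) pw; ring. Qed.

Lemma dot_plane_rot_w t x : dot w (plane_rot p w t x) = sin t * dot p x + cos t * dot w x.
Proof. by rewrite dot_plane_rot ww pw; ring. Qed.

Lemma plane_rot_isometry t x y : dot (plane_rot p w t x) (plane_rot p w t y) = dot x y.
Proof.
rewrite dot_plane_rot dot_plane_rot_p dot_plane_rot_w [dot (plane_rot _ _ _ _) y]dotC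
  dot_plane_rot (dotC dot y).
by have := cos2_sin2 t => h; ring: h.
Qed.

Lemma plane_rotN t x y : dot (plane_rot p w (- t) x) y = dot x (plane_rot p w t y).
Proof. by rewrite dotC !dot_plane_rot cosN sinN (dotC dot y); ring. Qed.

(** The rotation by [t + t] is a square, and the adjoint of one factor is the rotation by [- t]. *)
Lemma plane_rot_half t x y :
  dot x (plane_rot p w (t + t) y) = dot (plane_rot p w (- t) x) (plane_rot p w t y).
Proof.
rewrite plane_rotN dot_plane_rot [RHS]dot_plane_rot dot_plane_rot_p dot_plane_rot_w
  dot_plane_rot cosD sinD.
by have := cos2_sin2 t => h; ring: h.
Qed.

Lemma mem_plane_rot (U : {vspace V}) t x : p \in U -> w \in U -> x \in U ->
  plane_rot p w t x \in U.
Proof.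
by move=> pU wU xU; rewrite /plane_rot /plane_rotation !(rpredD, rpredB, rpredZ, rpredN).
Qed.

(* The rotation by [t] is the square of the rotation by [t / 2], whose
   determinant is [1] or [-1]. *)
Lemma det_dot_mx_plane_rot n (e u : 'I_n -> V) t : orthonormal_fam dot e ->
  p \in <<mktuple e>>%VS -> w \in <<mktuple e>>%VS ->
  (forall j, u j \in <<mktuple e>>%VS) ->
  \det (dot_mx dot e (plane_rot p w t \o u)) = \det (dot_mx dot e u).
Proof.
move=> oe pe we ue; rewrite [t]splitr; set s := t / 2.
have r_e r j : plane_rot p w r (e j) \in <<mktuple e>>%VS by rewrite mem_plane_rot ?mem_span_fam.
have orthr : orthonormal_fam dot (plane_rot p w (- s) \o e).
  by move=> i j /=; rewrite plane_rot_isometry.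
have d1 := det_dot_mx_sqr oe orthr (r_e _).
have -> : dot_mx dot e (plane_rot p w (s + s) \o u)
    = dot_mx dot (plane_rot p w (- s) \o e) (plane_rot p w s \o u).
  by apply/matrixP => i j; rewrite !mxE /= plane_rot_half.
(* The matrix of [e] against its own rotated family splits off twice, once for each half-angle, so
   its determinant enters as a square. *)
rewrite -(dot_mx_mul _ oe) => [|j]; last exact: mem_plane_rot.
have -> : dot_mx dot e (plane_rot p w s \o u) = dot_mx dot (plane_rot p w (- s) \o e) u.
  by apply/matrixP => i j; rewrite !mxE /= plane_rotN.
rewrite -(dot_mx_mul (plane_rot p w (- s) \o e) oe ue) !det_mulmx.
by rewrite -[dot_mx dot (_ \o _) e]tr_dot_mx det_tr mulrA -expr2 d1 mul1r.
Qed.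

(** The square equals [2 (1 - cos t) ((p.x)^2 + (w.x)^2)], and Bessel's inequality bounds the last
    factor by 1. *)
Lemma dnorm_plane_rotB t x : dot x x = 1 ->
  dnorm dot (plane_rot p w t x - x) ^+ 2 <= 4 * (1 - cos t).
Proof.
move=> x1; move: (plane_rot_isometry t x x) (dot_plane_rot t x x).
move: (plane_rot p w t x) => r; rewrite x1 => rr xr; rewrite sqr_dnorm !dotE rr x1 (dotC dot r) xr.
have h : dot p x ^+ 2 + dot w x ^+ 2 <= 1.
  have := dot_ge0 dot (x - dot p x *: p - dot w x *: w).
  rewrite !dotE (dotC dot x p) (dotC dot x w) (dotC dot w p) pp ww pw x1 => h.
  by nra.
have := cos_le1 t.
by nra.
Qed.

End OrthonormalPair.

Lemma rotationE u w t v : rotation dot u w t v = plane_rot (hat dot u w) w t v.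
Proof. by []. Qed.

End Rotation.

(** * Orientation of orthonormal families *)

Lemma det_mx22 (R : comNzRingType) (A : 'M[R]_2) :
  \det A = A ord0 ord0 * A ord_max ord_max - A ord0 ord_max * A ord_max ord0.
Proof.
have l1 : lift ord_max (0 : 'I_1) = ord0 :> 'I_2 by exact/val_inj.
have l0 : lift ord0 (0 : 'I_1) = ord_max :> 'I_2 by exact/val_inj.
rewrite (expand_det_row _ ord0) big_ord_recl big_ord1 l0 /cofactor !det_mx11 !mxE l0 l1.
by rewrite /= expr0 expr1; ring.
Qed.

Section Orientation.
Context {R : realType} {V : vectType R} (dot : {dot V for idfun}).
Implicit Types (u v w p x y : V) (a t : R).
Local Notation ortho := (orthonormal_fam dot).

(** In the plane of [p] and [w] the vector [U] has coordinates [(|r|, b)] with [|r|^2 = 1 - b^2].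
    Noncollinearity makes [|r|] positive, so the sign factor in [rotation_angle] is 1 and the
    rotation sends [(|r|, b)] to [(0, 1)]. *)
Lemma rotation_to_last n (e u : 'I_n.+1 -> V) :
    ortho e -> ortho u -> (forall j, u j \in <<mktuple e>>%VS) ->
    ~~ collinear_last e u ->
  let U := u ord_max in let w := e ord_max in let p := hat dot U w in
  [/\ dot p p = 1, dot p w = 0, p \in <<mktuple e>>%VS &
      plane_rot dot p w (rotation_angle dot U w) U = w].
Proof.
move=> oe ou ue ncol U w p.
have ww : dot w w = 1 by rewrite oe eqxx.
have UU : dot U U = 1 by rewrite ou eqxx.
set b := dot w U; set r := U - b *: w.
have pE : p = (dnorm dot r)^-1 *: r by [].
have wr : dot w r = 0 by rewrite !dotE ww mulr1 subrr.
have rr : dot r r = 1 - b ^+ 2.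
  by rewrite [in LHS]/r !dotE UU ww (dotC dot U) -/b; ring.
have r0 : r != 0.
  apply: contraNneq ncol => r0; move/eqP: rr; rewrite r0 dot0r eq_sym subr_eq0 eq_sym.
  rewrite sqrf_eq1 /collinear_last -/U -/w => b1.
  move/eqP: r0; rewrite subr_eq0 => /eqP ->.
  by case/orP: b1 => /eqP ->; rewrite ?scaleN1r ?scale1r eqxx ?orbT.
have n0 : 0 < dnorm dot r by rewrite dnorm_pos.
have pp : dot p p = 1 by exact: dot_unitv.
have pw : dot p w = 0 by rewrite dotC pE dotZr wr mulr0.
have rE : r = dnorm dot r *: p by rewrite pE scalerA divff ?scale1r ?gt_eqF.
have aE : dot p U = dnorm dot r.
  have <- : dot p r = dnorm dot r by rewrite [in LHS]rE dotZr pp mulr1.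
  by rewrite /r dotDr dotNr dotZr pw mulr0 subr0.
split => //.
  by rewrite pE rpredZ // rpredB ?rpredZ ?mem_span_fam //; apply: ue.
have [|] := @cos_sin_arccos R (dnorm dot r) b; first by rewrite sqr_dnorm rr subrK.
rewrite gt_eqF //; set T := (X in cos X) => cT sT.
have -> : rotation_angle dot U w = T by rewrite /rotation_angle -/p aE.
rewrite /plane_rot /plane_rotation aE -/b cT sT [b * _]mulrC subrr scale0r add0r.
by rewrite -!expr2 sqr_dnorm rr subrK scale1r -rE /r subKr subrr add0r.
Qed.

Lemma mem_span_lift n (e : 'I_n.+1 -> V) x : ortho e ->
  x \in <<mktuple e>>%VS -> dot (e ord_max) x = 0 ->
  x \in <<mktuple (fun i => e (lift ord_max i))>>%VS.
Proof.
move=> oe ex ex0; rewrite (orthonormal_fam_expand oe ex); apply: rpred_sum => i _.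
case: (unliftP ord_max i) => [j ->|->]; last by rewrite ex0 scale0r mem0v.
by rewrite rpredZ // (mem_span_fam (fun i => e (lift ord_max i))).
Qed.

Lemma orthonormal_lift n (e : 'I_n.+1 -> V) :
  ortho e -> ortho (fun i => e (lift ord_max i)).
Proof. by move=> oe i j; rewrite oe (inj_eq lift_inj). Qed.

(** The last column is a unit vector, so Laplace expansion leaves one minor, with sign
    [(-1)^(n+n)]. *)
Lemma det_dot_mx_lift n (e u : 'I_n.+1 -> V) : ortho e -> u ord_max = e ord_max ->
  \det (dot_mx dot e u) =
  \det (dot_mx dot (fun i => e (lift ord_max i)) (fun i => u (lift ord_max i))).
Proof.
move=> oe ue; rewrite (expand_det_col _ ord_max) (bigD1 ord_max) //= big1 => [|i im].
  rewrite !mxE ue oe eqxx mul1r /cofactor -signr_odd oddD addbb mul1r addr0.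
  by congr (\det _); apply/matrixP => i j; rewrite !mxE.
by rewrite !mxE ue oe (negPf im) mul0r.
Qed.

(** Stated for all [e], and with membership in the span of [e] instead of a basis of [V], because
    the recursion passes to a shorter family that spans only a hyperplane. *)
Definition orientation_spec n (S : ('I_n -> V) -> ('I_n -> V) -> R) :=
  forall e u : 'I_n -> V, ortho e -> ortho u -> (forall j, u j \in <<mktuple e>>%VS) ->
  S e u = \det (dot_mx dot e u).

Lemma orientation_generic n (S : ('I_n -> V) -> ('I_n -> V) -> R)
    (e u : 'I_n.+1 -> V) : orientation_spec S ->
  ortho e -> ortho u -> (forall j, u j \in <<mktuple e>>%VS) ->
  ~~ collinear_last e u ->
  S (fun i => e (lift ord_max i))
    (fun i => rotation dot (u ord_max) (e ord_max)
       (rotation_angle dot (u ord_max) (e ord_max)) (u (lift ord_max i))) =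
  \det (dot_mx dot e u).
Proof.
move=> specS oe ou ue ncol.
have [pp pw pe rU] := rotation_to_last oe ou ue ncol.
have ww : dot (e ord_max) (e ord_max) = 1 by rewrite oe eqxx.
have we := mem_span_fam e ord_max.
rewrite -(det_dot_mx_plane_rot pp ww pw (rotation_angle dot (u ord_max) (e ord_max)) oe pe we ue).
rewrite det_dot_mx_lift //; apply: specS.
- exact: orthonormal_lift.
- by move=> i j; rewrite plane_rot_isometry // ou (inj_eq lift_inj).
- move=> j; apply: mem_span_lift => //.
  by rewrite rotationE mem_plane_rot.
  (* [e ord_max] is itself the rotated last vector, so orthogonality to it is inherited from [u]. *)
  by rewrite -[X in dot X _]rU rotationE plane_rot_isometry // ou (negPf (neq_lift _ _)).
Qed.

(** A small rotation in the plane of the first and last vectors of [e] gives the last vector of [u]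
    a nonzero first coordinate. Two distinct indices are required, whence [n.+2]. *)
Lemma noncollinear_near n (e u : 'I_n.+2 -> V) (eps : R) :
    ortho e -> ortho u -> (forall j, u j \in <<mktuple e>>%VS) ->
    collinear_last e u -> 0 < eps ->
  exists u' : 'I_n.+2 -> V,
    [/\ ortho u', forall j, u' j \in <<mktuple e>>%VS,
        forall j, dnorm dot (u' j - u j) < eps & ~~ collinear_last e u'].
Proof.
move=> oe ou ue col eps0.
set p := e ord0; set w := e ord_max.
have ww : dot w w = 1 by rewrite oe eqxx.
have pp : dot p p = 1 by rewrite oe eqxx.
have pw : dot p w = 0 by rewrite oe.
(* With [cos t = 1 - d] the displacement has square at most [4 d <= eps^2 / 2 < eps^2]. The bound
   [d <= 1] keeps [1 - d] in the domain of [acos], and [0 < d <= 1] makes [sin t] nonzero. *)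
pose d : R := Num.min 1 (eps ^+ 2 / 8).
have d0 : 0 < d by rewrite lt_min ltr01 divr_gt0 ?exprn_gt0.
have d1 : d <= 1 by rewrite ge_min lexx.
have deps : d <= eps ^+ 2 / 8 by rewrite ge_min lexx orbT.
pose t := acos (1 - d).
have ct : cos t = 1 - d by rewrite acosK // in_itv /=; apply/andP; split; lra.
have st : sin t != 0.
  apply/eqP => st; have := cos2_sin2 t; rewrite st ct expr0n subr0 => h; nra.
have pe := mem_span_fam e ord0; have we := mem_span_fam e ord_max.
exists (fun j => plane_rot dot p w t (u j)); split.
- by move=> i j; rewrite plane_rot_isometry // ou.
- by move=> j; rewrite mem_plane_rot.
- move=> j; rewrite -(ltr_pXn2r (n := 2)) // ?nnegrE ?sqrtr_ge0 ?ltW //.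
  apply: le_lt_trans (dnorm_plane_rotB pp ww pw _ _) _; first by rewrite ou eqxx.
  by rewrite ct; have := exprn_gt0 2 eps0; lra.
have wE : dot w (u ord_max) != 0.
  by move: col => /orP[] /eqP ->; rewrite ?dotNr ww ?oppr_eq0 oner_eq0.
have pE : dot p (u ord_max) = 0.
  by move: col => /orP[] /eqP ->; rewrite ?dotNr pw ?oppr0.
have: dot p (plane_rot dot p w t (u ord_max)) != 0.
  by rewrite dot_plane_rot_p // pE mulr0 sub0r oppr_eq0 mulf_neq0.
apply: contraNN => /orP[] /eqP ->; first by rewrite pw.
by rewrite dotNr pw oppr0.
Qed.

Lemma orientation_step_spec n (S : ('I_n.+1 -> V) -> ('I_n.+1 -> V) -> R) :
  orientation_spec S -> orientation_spec (orientation_step dot S).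
Proof.
move=> specS e u oe ou ue; rewrite /orientation_step.
case: ifPn => [col|ncol]; last exact: orientation_generic.
(* The families have [n.+2] members, so this is the radius of [det_dot_mx_near]. *)
have n0 : 0 < n.+3%:R^-1 :> R by rewrite invr_gt0 ltr0n.
apply: xget_subset1 => [|s1 s2].
  exists n.+3%:R^-1 => // u' /(orthonormal_basis_ofP _ oe)[ou' u'e] near ncol'.
  by rewrite orientation_generic // (det_dot_mx_near oe ou).
(* Uniqueness: an admissible [s] is the generic value at a noncollinear family close to [u]. If no
   such family existed, every [s] would be admissible. *)
suff det s : [set s | exists2 eps : R, 0 < eps & forall u' : 'I_n.+2 -> V,
      orthonormal_basis_of dot <<mktuple e>>%VS u' ->
      (forall i, dnorm dot (u' i - u i) < eps) -> ~~ collinear_last e u' ->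
      S (fun i => e (lift ord_max i)) (fun i => rotation dot (u' ord_max) (e ord_max)
       (rotation_angle dot (u' ord_max) (e ord_max)) (u' (lift ord_max i))) = s]%classic s ->
    s = \det (dot_mx dot e u).
  by move=> /det -> /det ->.
move=> [eps eps0 Ps].
have [|u' [ou' u'e near ncol]] :=
  @noncollinear_near _ e u (Num.min eps n.+3%:R^-1) oe ou ue col.
  by rewrite lt_min eps0.
have [near1 near2] : (forall i, dnorm dot (u' i - u i) < eps) /\
    (forall i, dnorm dot (u' i - u i) < n.+3%:R^-1).
  by split=> i; have := near i; rewrite lt_min => /andP[].
rewrite -(Ps u') ?orientation_generic ?(det_dot_mx_near oe ou) //.
exact/orthonormal_basis_ofP.
Qed.

Lemma det_pm1 n (e u : 'I_n -> V) : ortho e -> ortho u ->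
  (forall j, u j \in <<mktuple e>>%VS) ->
  \det (dot_mx dot e u) = 1 \/ \det (dot_mx dot e u) = - 1.
Proof.
move=> oe ou ue; have /eqP := det_dot_mx_sqr oe ou ue.
by rewrite sqrf_eq1 => /orP[] /eqP; [left|right].
Qed.

Lemma orientation1_spec : orientation_spec (@orientation1 R V).
Proof.
move=> e u oe ou ue; rewrite /orientation1.
have u0 : u ord0 = \det (dot_mx dot e u) *: e ord0.
  by rewrite det_mx11 mxE {1}(orthonormal_fam_expand oe (ue ord0)) big_ord1.
have [|] := det_pm1 oe ou ue => du; rewrite u0 du {u0}; first by rewrite scale1r !eqxx.
rewrite scaleN1r; case: eqP => // /(congr1 (dot (e ord0))); rewrite dotNr oe eqxx /=.
by move=> h; exfalso; lra.
Qed.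

(** The rotation that brings [u_2] to [e_2] gives [u_1] the second coordinate [u_1 . u_2 = 0] and
    the first coordinate [y a - x b], which is the determinant. *)
Lemma orientation2_spec : orientation_spec (@orientation2 R V dot).
Proof.
move=> e u oe ou ue.
have e01 : dot (e ord0) (e ord_max) = 0 by rewrite oe.
have e00 : dot (e ord0) (e ord0) = 1 by rewrite oe.
have e11 : dot (e ord_max) (e ord_max) = 1 by rewrite oe.
have uE j : u j = dot (e ord0) (u j) *: e ord0 + dot (e ord_max) (u j) *: e ord_max.
  by rewrite {1}(orthonormal_fam_expand oe (ue j)) big_ord_recl big_ord1
    (_ : lift ord0 ord0 = ord_max) //; exact/val_inj.
set x := dot (e ord0) (u ord_max); set y := dot (e ord_max) (u ord_max).
set a := dot (e ord0) (u ord0); set b := dot (e ord_max) (u ord0).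
have dE : \det (dot_mx dot e u) = y * a - x * b.
  by rewrite det_mx22 !mxE -/a -/b -/x -/y; ring.
have xy1 : x ^+ 2 + y ^+ 2 = 1.
  have := ou ord_max ord_max; rewrite eqxx {1}uE !dotE -/x -/y => h; rewrite !expr2; exact: h.
have ab : x * a + y * b = 0.
  have := ou ord_max ord0; rewrite /= {1}uE !dotE -/x -/y -/a -/b => h; exact: h.
have [cT sT] := cos_sin_arccos xy1.
rewrite /orientation2 /plane_rotation -/x -/y -/a -/b cT sT ab scale0r addr0 -dE.
have [|] := det_pm1 oe ou ue => du; rewrite du; first by rewrite scale1r !eqxx.
rewrite scaleN1r; case: eqP => // /(congr1 (dot (e ord0))); rewrite dotNr e00.
by move=> h; exfalso; lra.
Qed.

Lemma orientation_onb_spec n : orientation_spec (@orientation_onb R V dot n).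
Proof.
elim: n => [|[|[|n]] IHn].
- by move=> e u _ _ _; rewrite /= det_mx00.
- exact: orientation1_spec.
- exact: orientation2_spec.
- exact: orientation_step_spec.
Qed.

End Orientation.

(** * Gram-Schmidt *)

Section GramSchmidt.
Context {R : realType} {V : vectType R} (dot : {dot V for idfun}).
Implicit Types (u v w p x y : V) (us vs : seq V).

(** The last two clauses say that the matrix of [us] against [vs] is upper triangular with positive
    diagonal; this is what the determinant needs. *)
Definition orthonormalization us vs :=
  [/\ size us = size vs, <<us>>%VS = <<vs>>%VS,
      forall i j, (i < size us)%N -> (j < size us)%N ->
        dot us`_i us`_j = (i == j)%:R,
      forall i, (i < size us)%N -> 0 < dot us`_i vs`_i &
      forall i j, (j < i < size us)%N -> dot us`_i vs`_j = 0].

Lemma orthonormalization_rcons us vs v : orthonormalization us vs ->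
  v \notin <<vs>>%VS ->
  orthonormalization (rcons us (unitv dot (v - \sum_(u <- us) dot v u *: u)))
    (rcons vs v).
Proof.
move=> [sz sp ou pos tri] v_vs; set r := v - _; set w := unitv dot r.
have sum_us : \sum_(u <- us) dot v u *: u \in <<us>>%VS.
  by rewrite big_seq rpred_sum // => u uus; rewrite rpredZ // memv_span.
have r0 : r != 0.
  by apply: contraNneq v_vs => /eqP; rewrite subr_eq0 -sp => /eqP ->.
have n0 : 0 < dnorm dot r by rewrite dnorm_pos.
have ur i : (i < size us)%N -> dot us`_i r = 0.
  move=> il; rewrite /r dotDr dotNr dot_sumr (big_nth 0) big_mkord.
  rewrite (bigD1 (Ordinal il)) //= dotZr ou // eqxx mulr1 (dotC dot v) big1 ?addr0 ?subrr //.
  move=> j /negPf ji; rewrite dotZr ou // (_ : (i == j) = false) ?mulr0 // eq_sym.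
  by rewrite -ji.
have xr x : x \in <<us>>%VS -> dot x r = 0.
  move=> /(@coord_span _ _ _ (in_tuple us)) ->; rewrite dot_suml big1 // => i _.
  by rewrite dotZl ur ?mulr0.
have wE y : dot w y = (dnorm dot r)^-1 * dot r y by rewrite /w /unitv dotZl.
(* [v - r] lies in the span of [us], to which [r] is orthogonal. This makes the new diagonal entry
   positive. *)
have rv : dot r v = dot r r.
  by rewrite -[in LHS](subrK (\sum_(u <- us) dot v u *: u) v) -/r dotDr
    (dotC dot r (\sum_(u <- _) _)) (xr _ sum_us) addr0.
have rE : r = dnorm dot r *: w by rewrite /w /unitv scalerA divff ?scale1r ?gt_eqF.
have uw i : (i < size us)%N -> dot us`_i w = 0.
  by move=> il; rewrite dotC wE dotC ur ?mulr0.
split.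
- by rewrite !size_rcons sz.
- have sub_vs : (<<vs>> <= <<rcons vs v>>)%VS.
    by apply: sub_span => y yvs; rewrite mem_rcons inE yvs orbT.
  apply/eqP; rewrite eqEsubv; apply/andP; split; apply/span_subvP => x.
    rewrite mem_rcons inE => /orP[/eqP ->|xus].
      rewrite rpredZ // rpredB //; first by rewrite memv_span // mem_rcons mem_head.
      by apply: (subvP sub_vs); rewrite -sp.
    by apply: (subvP sub_vs); rewrite -sp memv_span.
  have sub : (<<us>> <= <<rcons us w>>)%VS.
    by apply: sub_span => y yvs; rewrite mem_rcons inE yvs orbT.
  rewrite mem_rcons inE => /orP[/eqP ->|xvs]; last first.
    by apply: (subvP sub); rewrite sp memv_span.
  rewrite -[v](subrK (\sum_(u <- us) dot v u *: u)) -/r rpredD //; last exact: (subvP sub).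
  by rewrite rE rpredZ // memv_span // mem_rcons mem_head.
- move=> i j; rewrite !size_rcons !ltnS !nth_rcons.
  case: (ltngtP i (size us)) => //= [il|il]; case: (ltngtP j (size us)) => //= [jl|jl] _ _.
  + exact: ou.
  + by rewrite uw // jl ltn_eqF.
  + by rewrite dotC uw // il gtn_eqF.
  + by rewrite dot_unitv // il jl eqxx.
- move=> i; rewrite size_rcons ltnS !nth_rcons sz.
  case: (ltngtP i (size vs)) => //= [il|_] _; first by apply: pos; rewrite sz.
  by rewrite wE rv mulr_gt0 ?invr_gt0 // dot_gt0.
- move=> i j; rewrite size_rcons ltnS => /andP[ji]; rewrite !nth_rcons -sz.
  case: (ltngtP i (size us)) => //= [il|il] _.
    by rewrite (ltn_trans ji il); apply: tri; rewrite ji.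
  rewrite -il ji wE dotC xr ?mulr0 // sp memv_span // mem_nth //.
  by rewrite -sz -il.
Qed.

Lemma gram_schmidt_seqP vs : free vs ->
  orthonormalization (gram_schmidt_seq dot vs) vs.
Proof.
elim/last_ind: vs => [|vs v IHvs]; first by split=> //= i j /andP[_].
rewrite (perm_free (permEl (perm_rcons v vs))) free_cons => /andP[v_vs /IHvs].
by rewrite /gram_schmidt_seq foldl_rcons => h; apply: orthonormalization_rcons.
Qed.

(** The matrix of [v] factors through the Gram-Schmidt family, and [t] is the product of the
    diagonal of the triangular factor. *)
Lemma det_gram_schmidt n (e v : 'I_n -> V) :
    orthonormal_fam dot e -> basis_of fullv (mktuple e) -> free (mktuple v) ->
  orthonormal_fam dot (gram_schmidt dot v) /\
  exists2 t : R, 0 < t &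
    \det (dot_mx dot e v) = \det (dot_mx dot e (gram_schmidt dot v)) * t.
Proof.
move=> oe be /gram_schmidt_seqP[sz _ ou pos tri].
have {}sz : size (gram_schmidt_seq dot (mktuple v)) = n by rewrite sz size_tuple.
have vE (i : 'I_n) : (mktuple v)`_i = v i by rewrite -tnth_nth tnth_mktuple.
have ogs : orthonormal_fam dot (gram_schmidt dot v).
  by move=> i j; rewrite /gram_schmidt ou ?sz.
have full (u : 'I_n -> V) : orthonormal_fam dot u -> <<mktuple u>>%VS = fullv.
  move=> /orthonormal_fam_free; rewrite /free => fu; apply/eqP.
  move: be; rewrite /basis_of => /andP[/eqP be fe].
  rewrite eqEdim subvf -be (eqP fu) (leq_trans (dim_span _)) //.
  by rewrite !size_tuple.
split => //; exists (\prod_i dot (gram_schmidt dot v i) (v i)).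
  by apply: prodr_gt0 => i _; rewrite /gram_schmidt -[v i]vE pos ?sz.
rewrite -(dot_mx_mul e ogs) => [|j]; last by rewrite full // memvf.
rewrite det_mulmx -(det_tr (dot_mx dot (gram_schmidt dot v) v)) (@det_trig _ _ (_^T)).
  by congr (_ * _); apply: eq_bigr => i _; rewrite !mxE.
apply/is_trig_mxP => i j ij; rewrite !mxE /gram_schmidt -[v i]vE tri // ij /=.
by rewrite sz.
Qed.

Lemma orientation_det n (e v : 'I_n -> V) :
    orthonormal_fam dot e -> basis_of fullv (mktuple e) -> free (mktuple v) ->
  orientation dot e v * `|\det (dot_mx dot e v)| = \det (dot_mx dot e v).
Proof.
move=> oe be fv; have [ou [t t0 ->]] := det_gram_schmidt oe be fv.
have ue j : gram_schmidt dot v j \in <<mktuple e>>%VS by rewrite (span_basis be) memvf.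
rewrite /orientation orientation_onb_spec // normrM (gtr0_norm t0) mulrA; congr (_ * _).
by have [|] := det_pm1 oe ou ue => ->; rewrite ?normrN normr1 mulr1.
Qed.

Lemma det_dot_mx_neq0 n (e v : 'I_n -> V) :
    orthonormal_fam dot e -> basis_of fullv (mktuple e) ->
  (\det (dot_mx dot e v) != 0) = basis_of fullv (mktuple v).
Proof.
move=> oe be; apply/idP/idP => [d0|bv]; last first.
  have [ou [t t0 ->]] := det_gram_schmidt oe be (basis_free bv).
  have ue j : gram_schmidt dot v j \in <<mktuple e>>%VS by rewrite (span_basis be) memvf.
  by rewrite mulf_neq0 ?(gt_eqF t0) //; have [|] := det_pm1 oe ou ue => ->;
    rewrite ?oppr_eq0 oner_eq0.
have fv : free (mktuple v).
  apply/freeP => k k0; suff /rowP row0 : \row_i k i = 0 by move=> i; have := row0 i; rewrite !mxE.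
  apply/eqP; apply: contraNT d0 => k1; rewrite -det_tr; apply/det0P.
  exists (\row_i k i) => //; apply/rowP => j; rewrite !mxE.
  rewrite -[RHS](dot0r dot (e j)) -k0 dot_sumr; apply: eq_bigr => i _.
  by rewrite !mxE -tnth_nth tnth_mktuple dotZr.
by rewrite basisEfree fv subvf size_tuple -(size_basis be) /=.
Qed.

End GramSchmidt.

(** * Measurability and translation in coordinates *)

Lemma additive_nonneg_linear (R : realType) (g : R -> R) :
  (forall a b, 0 <= a -> 0 <= b -> g (a + b) = g a + g b) ->
  (forall a, 0 <= a -> 0 <= g a) -> forall c, 0 <= c -> g c = c * g 1.
Proof.
move=> gD g0 c c0.
have gM k a : 0 <= a -> g (k%:R * a) = k%:R * g a.
  move=> a0; elim: k => [|k IHk]; last first.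
    by rewrite -natr1 mulrDl mul1r gD ?mulr_ge0 // IHk; ring.
  by rewrite !mul0r; have := gD 0 0 (lexx _) (lexx _); rewrite addr0 => h; lra.
have gmono a b : 0 <= a -> a <= b -> g a <= g b.
  by move=> a0 ab; rewrite -(subrK a b) gD ?subr_ge0 // lerDr g0 // subr_ge0.
(* With [m] the integer part of [(k + 1) c], both [(k + 1) g c] and [(k + 1) c g 1] lie between
   [m g 1] and [(m + 1) g 1]. *)
have close k : `|g c - c * g 1| * k.+1%:R <= g 1.
  have kc0 : 0 <= k.+1%:R * c by rewrite mulr_ge0.
  have /andP[lo hi] := truncn_itv kc0; set m := Num.truncn _ in lo hi.
  have g10 := g0 1 ler01.
  have h1 : m%:R * g 1 <= k.+1%:R * g c by rewrite -!gM // mulr1 gmono.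
  have h2 : k.+1%:R * g c <= m.+1%:R * g 1 by rewrite -!gM // mulr1 gmono // ltW.
  rewrite -[X in _ * X]ger0_norm // -normrM ler_norml mulrBl.
  by apply/andP; split; rewrite -natr1 in h2 hi *; nra.
apply/eqP; rewrite -subr_eq0 -normr_eq0; apply: contraT => d0.
have dp : 0 < `|g c - c * g 1| by rewrite lt_def d0 /=.
have := close (Num.truncn (g 1 / `|g c - c * g 1|)); rewrite mulrC -ler_pdivlMr //.
by rewrite leNgt truncnS_gt.
Qed.

Section Volume.
Context {R : realType} {V : vectType R} (dot : {dot V for idfun}).
Context (n : nat) (e : 'I_n -> V).
Hypotheses (oe : orthonormal_fam dot e) (be : basis_of fullv (mktuple e)).

Local Notation bmeasurable A := (measurable (A : set (borelV dot))).

(** The half-space is open because a linear form is Lipschitz for [dnorm]. *)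
Lemma halfspace_measurable (f : {scalar V}) (c : R) :
  bmeasurable [set x : V | f x < c].
Proof.
apply: sub_gen_smallest => x /= fxc.
(* The summand 1 keeps the Lipschitz constant positive even for [f = 0]. *)
pose C := \sum_i `|f (e i)| + 1.
have C0 : 0 < C by rewrite ltr_wpDl // sumr_ge0.
have fC y : `|f y| <= C * dnorm dot y.
  rewrite [in f y](orthonormal_fam_expand oe (_ : y \in _)); last first.
    by rewrite (span_basis be) memvf.
  rewrite linear_sum (le_trans (ler_norm_sum _ _ _)) //.
  rewrite mulrDl mulr_suml ler_wpDr // ?mul1r ?sqrtr_ge0 // ler_sum // => i _.
  by rewrite linearZ /= normrM mulrC ler_wpM2l // dot_unit_le ?oe ?eqxx.
exists ((c - f x) / C) => [|y]; first by rewrite divr_gt0 // subr_gt0.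
rewrite ltr_pdivlMr // mulrC => h.
have := le_lt_trans (fC (y - x)) h.
by rewrite linearB /= => /ltr_normlW; rewrite ltrD2r.
Qed.

Section Coordinates.
Variable (v : 'I_n -> V).
Hypothesis (bv : basis_of fullv (mktuple v)).

Definition coords x : 'I_n -> R := fun i => coord (mktuple v) i x.

Definition coord_set (A : set ('I_n -> R)) : set V := [set x | A (coords x)].

Lemma coords_sum (s : 'I_n -> R) : coords (\sum_k s k *: v k) = s.
Proof.
apply/funext => i; rewrite /coords.
under eq_bigr => k _ do rewrite -[v k](tnth_mktuple v) (tnth_nth 0).
by rewrite coord_sum_free // (basis_free bv).
Qed.

Lemma sum_coords x : \sum_k coords x k *: v k = x.
Proof.
rewrite [RHS](coord_basis bv (memvf x)); apply: eq_bigr => k _.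
by rewrite -tnth_nth tnth_mktuple.
Qed.

Lemma parallelepipedE :
  parallelepiped v = coord_set [set t | forall i, 0 <= t i < 1].
Proof.
apply/seteqP; split => [x [t t01 ->]|x x01]; rewrite /coord_set /=.
  by rewrite coords_sum.
by exists (coords x) => //; rewrite sum_coords.
Qed.

Lemma measurable_coord_lt i c : bmeasurable (coord_set [set t | t i < c]).
Proof. exact: (halfspace_measurable (coord (mktuple v) i)). Qed.

Lemma measurable_coord_ge i c : bmeasurable (coord_set [set t | c <= t i]).
Proof.
have -> : coord_set [set t | c <= t i] = ~` coord_set [set t | t i < c].
  by apply/seteqP; split => x /=; rewrite /coord_set /= leNgt => /negP.
by apply: measurableC; exact: measurable_coord_lt.
Qed.

Lemma measurable_coord_gt i c : bmeasurable (coord_set [set t | c < t i]).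
Proof.
have -> : coord_set [set t | c < t i] =
    [set x | (\- coord (mktuple v) i : {scalar V}) x < - c].
  by apply/seteqP; split => x /=; rewrite /coord_set /= ltrN2.
exact: halfspace_measurable.
Qed.

Lemma measurable_coord_le i c : bmeasurable (coord_set [set t | t i <= c]).
Proof.
have -> : coord_set [set t | t i <= c] = ~` coord_set [set t | c < t i].
  by apply/seteqP; split => x /=; rewrite /coord_set /= leNgt => /negP.
by apply: measurableC; exact: measurable_coord_gt.
Qed.

Lemma measurable_coord_ltc i j : bmeasurable (coord_set [set t | t i < t j]).
Proof.
have -> : coord_set [set t | t i < t j] =
    [set x | (coord (mktuple v) i \- coord (mktuple v) j : {scalar V}) x < 0].
  by apply/seteqP; split => x /=; rewrite /coord_set /= subr_lt0.
exact: halfspace_measurable.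
Qed.

Lemma measurable_coord_setI A B : bmeasurable (coord_set A) ->
  bmeasurable (coord_set B) -> bmeasurable (coord_set (A `&` B)).
Proof. exact: measurableI. Qed.

Lemma measurable_coord_setC A :
  bmeasurable (coord_set A) -> bmeasurable (coord_set (~` A)).
Proof. exact: measurableC. Qed.

(** The unit cube in all directions but [i]. The condition [A] may involve the other coordinates
    too, as the shear requires. *)
Definition slab i (A : set ('I_n -> R)) : set ('I_n -> R) :=
  [set t | (forall k, k != i -> 0 <= t k < 1) /\ A t].

Lemma measurable_slab i A :
  bmeasurable (coord_set A) -> bmeasurable (coord_set (slab i A)).
Proof.
move=> mA; apply: (@measurable_coord_setI [set t | forall k, k != i -> 0 <= t k < 1]) => //.
have -> : coord_set [set t | forall k, k != i -> 0 <= t k < 1] =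
    \bigcap_(k in [set k | k != i])
      coord_set ([set t | 0 <= t k] `&` [set t | t k < 1]).
  apply/seteqP; split => x /= h k ki; last by apply/andP; apply: h.
  by have /andP := h k ki.
apply: fin_bigcap_measurable => [|k _]; first exact: finite_finset.
by apply: measurable_coord_setI;
  [exact: measurable_coord_ge|exact: measurable_coord_lt].
Qed.

Section Measure.
Variable (mu : {measure set (borelV dot) -> \bar R}).
Hypothesis mu_trans : translation_invariant dot mu.

Lemma mu_coord_shift A (s : 'I_n -> R) : bmeasurable (coord_set A) ->
  mu (coord_set [set t | A (fun k => t k - s k)]) = mu (coord_set A).
Proof.
move=> mA; rewrite -(mu_trans (\sum_k s k *: v k) mA); congr (mu _).
have cB x : coords (x - \sum_k s k *: v k) = (fun k => coords x k - s k).
  by apply/funext => k; rewrite -[s in RHS]coords_sum /coords linearB.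
apply/seteqP; split => [x Ax|_ [y Ay <-]]; rewrite /coord_set /=.
  by exists (x - \sum_k s k *: v k); [rewrite /coord_set /= cB|rewrite addrC subrK].
by rewrite -cB addrC addKr.
Qed.

Lemma mu_coord_setU A B : bmeasurable (coord_set A) -> bmeasurable (coord_set B) ->
  (forall t, A t -> B t -> False) ->
  mu (coord_set (A `|` B)) = (mu (coord_set A) + mu (coord_set B))%E.
Proof.
move=> mA mB AB; rewrite -measureU //.
by apply/seteqP; split => // x [Ax Bx]; apply: (AB _ Ax Bx).
Qed.

End Measure.
End Coordinates.
End Volume.

(** * Volume under elementary operations *)

Section DeterminantOfFamily.
Context {R : realType} {V : vectType R} (dot : {dot V for idfun}).
Context (n : nat) (e : 'I_n -> V).
Local Notation D v := (\det (dot_mx dot e v)).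
Local Notation upd v i x := (@dfwith _ (fun=> V) v i x).

Lemma dfwithE (v : 'I_n -> V) i x k : upd v i x k = if k == i then x else v k.
Proof.
have [->|ki] := eqVneq; first by rewrite dfwithin.
by rewrite dfwithout // eq_sym.
Qed.

Lemma det_dot_mx_multilinear : multilinear_map (fun v => D v).
Proof.
move=> v i a x y /=; rewrite -!(det_tr (dot_mx _ _ _)) !tr_dot_mx.
rewrite -[X in _ = _ + X]mul1r.
apply: (@determinant_multilinear _ _ _ _ _ i).
- by apply/rowP => j; rewrite !mxE !dfwithin mul1r !dotE.
- by apply/matrixP => k j; rewrite !mxE !dfwithout ?neq_lift.
- by apply/matrixP => k j; rewrite !mxE !dfwithout ?neq_lift.
Qed.

Lemma det_dot_mx_alternating : alternating_map (fun v => D v).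
Proof.
move=> v i j ij; rewrite -!(det_tr (dot_mx _ _ _)) !tr_dot_mx.
have -> : dot_mx dot (fun k => v (tperm i j k)) e = row_perm (tperm i j) (dot_mx dot v e).
  by apply/matrixP => k l; rewrite !mxE.
by rewrite row_permE det_mulmx det_perm odd_tperm ij expr1 mulN1r.
Qed.

Lemma det_dot_mxZ v i c : D (upd v i (c *: v i)) = c * D v.
Proof.
have /(_ c (v i) 0) := det_dot_mx_multilinear v i; rewrite addr0 => ->.
(* Linearity at [-1, 0, 0] reads [D0 = - D0 + D0], so a zero vector gives determinant 0. *)
have /(_ (-1) 0 0) := det_dot_mx_multilinear v i; rewrite scaler0 addr0 => D0.
have -> : upd v i (v i) = v by apply/funext => k; rewrite dfwithE; case: eqP => [->|].
by lra.
Qed.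

Lemma det_dot_mx_add v i j : i != j -> D (upd v i (v i + v j)) = D v.
Proof.
move=> ij; have /(_ 1 (v i) (v j)) := det_dot_mx_multilinear v i; rewrite scale1r mul1r => ->.
have -> : upd v i (v i) = v by apply/funext => k; rewrite dfwithE; case: eqP => [->|].
rewrite -[X in _ + X]det_tr tr_dot_mx (determinant_alternate ij) ?addr0 // => k.
by rewrite !mxE dfwithin dfwithout.
Qed.

End DeterminantOfFamily.

Section VolumeSteps.
Context {R : realType} {V : vectType R} (dot : {dot V for idfun}).
Context (n : nat) (e : 'I_n -> V).
Hypotheses (oe : orthonormal_fam dot e) (be : basis_of fullv (mktuple e)).
Variable (mu : {measure set (borelV dot) -> \bar R}).
Hypothesis mu_trans : translation_invariant dot mu.
Local Notation D v := (\det (dot_mx dot e v)).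
Local Notation upd v i x := (@dfwith _ (fun=> V) v i x).
Local Notation vol v := (mu (parallelepiped v)).
Implicit Types (v : 'I_n -> V).

Lemma parallelepiped_slab v i : basis_of fullv (mktuple v) ->
  parallelepiped v = coord_set v (slab i ([set t | 0 <= t i] `&` [set t | t i < 1])).
Proof.
move=> bv; rewrite parallelepipedE //; congr (coord_set v _).
apply/seteqP; split => t /= h; first by split=> [k _|]; [exact: h|exact/andP].
move=> k; case: (eqVneq k i) => [->|/(proj1 h) //].
by apply/andP; exact: (proj2 h).
Qed.

(** Used to describe the cube of a modified family [w] in the coordinates of [v], so that both cubes
    are compared there. *)
Lemma coordsE v w (s : 'I_n -> R) x : basis_of fullv (mktuple v) ->
  basis_of fullv (mktuple w) ->
  \sum_k coords v x k *: v k = \sum_k s k *: w k -> coords w x = s.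
Proof. by move=> bv bw; rewrite (sum_coords bv) => ->; rewrite coords_sum. Qed.

(** [G a] is the volume of the cube of [v] with side [[0, a)] in direction [i]. It is additive in
    [a], hence linear. *)
Lemma vol_scale_pos v i c (d : R) : basis_of fullv (mktuple v) -> 0 < c ->
  basis_of fullv (mktuple (upd v i (c *: v i))) ->
  vol v = d%:E -> vol (upd v i (c *: v i)) = (c * d)%:E.
Proof.
move=> bv c0 bw vold.
pose S a := slab i ([set t | 0 <= t i] `&` [set t : 'I_n -> R | t i < a]).
pose G a := mu (coord_set v (S a)).
have mS a : measurable (coord_set v (S a) : set (borelV dot)).
  by apply: (measurable_slab oe be); apply: measurable_coord_setI;
    [exact: (measurable_coord_ge oe be)|exact: (measurable_coord_lt oe be)].
have G1 : G 1 = d%:E by rewrite -vold (parallelepiped_slab i bv).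
(* The part [a <= t i < a + b] is the slab of height [b] translated by [a *: v i]. *)
have GD a b : 0 <= a -> 0 <= b -> G (a + b) = (G a + G b)%E.
  move=> a0 b0; pose s k := if k == i then a else 0.
  have sI : s i = a by rewrite /s eqxx.
  have sN k : k != i -> s k = 0 by rewrite /s => /negPf ->.
  rewrite /G -(mu_coord_shift bv mu_trans s (mS b)) -mu_coord_setU //.
  - congr (mu (coord_set v _)); apply/seteqP; split => t /=.
      move=> [h [/= t0 tab]]; have [ta|ta] := ltP (t i) a; [left|right]; split => //.
        by move=> k ki; rewrite sN // subr0; apply: h.
      by split => /=; rewrite sI; lra.
    move=> [[h [/= t0 ta]]|[h [/= t0 ta]]]; split => //=; first by split => //; lra.
      by move=> k ki; have := h k ki; rewrite sN // subr0.
    by move: t0 ta; rewrite /= sI => t0 ta; split; lra.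
  - have -> : coord_set v [set t | S b (fun k => t k - s k)] =
        coord_set v (slab i ([set t | a <= t i] `&` [set t | t i < a + b])).
      apply/seteqP; split => x; rewrite /coord_set /= => -[h [/= t0 tb]]; split.
      + by move=> k ki; have := h k ki; rewrite sN // subr0.
      + by move: t0 tb; rewrite /= sI => t0 tb; split => /=; lra.
      + by move=> k ki; rewrite sN // subr0; apply: h.
      + by move: t0 tb; rewrite /= sI => t0 tb; split => /=; lra.
    by apply: (measurable_slab oe be); apply: measurable_coord_setI;
      [exact: (measurable_coord_ge oe be)|exact: (measurable_coord_lt oe be)].
  - by move=> t [_ [/= _ ta]] [_ [/=]]; rewrite sI => tb _; lra.
have Gmono a b : a <= b -> (G a <= G b)%E.
  move=> ab; apply: le_measure; rewrite ?inE //.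
  by move=> x [h [/= t0 ta]]; split => //; split => //=; move: ta => /=; lra.
have Gnat k : G k%:R = (k%:R * d)%:E.
  elim: k => [|k IHk]; last by rewrite -natr1 GD // IHk G1 -EFinD mulrDl mul1r.
  rewrite mul0r /G; set A := coord_set v _; have -> : A = set0; last exact: measure0.
  by apply/seteqP; split => // x [_ [/= h1 h2]]; lra.
(* The real-valued argument needs finite values; [G a] is bounded by [G] at a larger natural number,
   which is a multiple of [d]. *)
have Gfin a : G a \is a fin_num.
  rewrite ge0_fin_numE //; apply: le_lt_trans (Gmono a (Num.truncn a).+1%:R _) _.
    exact/ltW/truncnS_gt.
  by rewrite Gnat ltry.
have -> : vol (upd v i (c *: v i)) = G c.
  rewrite (parallelepiped_slab i bw); congr (mu _); apply/funext => x /=.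
  rewrite /coord_set /=.
  rewrite (@coordsE v _ (fun k => if k == i then coords v x k / c else coords v x k) x) //.
    apply/propext; split => -[h [/= t0 t1]]; split => [k ki|].
    - by have := h k ki; rewrite (negPf ki).
    - move: t0 t1; rewrite /= eqxx => t0 t1; split => /=.
        by rewrite -(pmulr_lge0 _ (_ : 0 < c^-1)) ?invr_gt0 // mulrC.
      by rewrite ltr_pdivrMr // mul1r in t1.
    - by rewrite (negPf ki); apply: h.
    - move: t0 t1 => /= t0 t1; rewrite eqxx; split => /=.
        by rewrite divr_ge0 // ltW.
      by rewrite ltr_pdivrMr // mul1r.
  apply: eq_bigr => k _; rewrite dfwithE; case: eqP => // ->.
  by rewrite scalerA divfK // gt_eqF.
rewrite -(fineK (Gfin c)); congr (_%:E).
rewrite -[d]/(fine d%:E) -G1; move: c {bw} c0 => c /ltW; move: c.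
apply: (@additive_nonneg_linear R (fun a => fine (G a))) => [a b a0 b0|a a0].
  by rewrite GD // fineD.
exact/fine_ge0.
Qed.

(* The cubes of [v] and of the modified family differ, after a translation, by two
   opposite faces, which are translates of each other. *)
Lemma vol_opp v i : basis_of fullv (mktuple v) ->
  basis_of fullv (mktuple (upd v i (- v i))) -> vol (upd v i (- v i)) = vol v.
Proof.
move=> bv bw.
pose S a b := slab i ([set t | a <= t i] `&` [set t : 'I_n -> R | t i <= b]).
pose I := slab i ([set t | 0 < t i] `&` [set t : 'I_n -> R | t i < 1]).
have mS a b : measurable (coord_set v (S a b) : set (borelV dot)).
  by apply: (measurable_slab oe be); apply: measurable_coord_setI;
    [exact: (measurable_coord_ge oe be)|exact: (measurable_coord_le oe be)].
have mI : measurable (coord_set v I : set (borelV dot)).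
  by apply: (measurable_slab oe be); apply: measurable_coord_setI;
    [exact: (measurable_coord_gt oe be)|exact: (measurable_coord_lt oe be)].
pose s k : R := if k == i then 1 else 0.
have sI : s i = 1 by rewrite /s eqxx.
have sN k : k != i -> s k = 0 by rewrite /s => /negPf ->.
have faces : mu (coord_set v (S 1 1)) = mu (coord_set v (S 0 0)).
  rewrite -[RHS](mu_coord_shift bv mu_trans s (mS 0 0)); congr (mu (coord_set v _)).
  apply/seteqP; split => t /= -[h [/= t0 t1]]; split => [k ki|/=].
  - by rewrite sN // subr0; apply: h.
  - by split => /=; rewrite sI; lra.
  - by have := h k ki; rewrite sN // subr0.
  - by move: t0 t1; rewrite sI => t0 t1; split => /=; lra.
have -> : vol v = (mu (coord_set v I) + mu (coord_set v (S 0%R 0%R)))%E.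
  rewrite (parallelepiped_slab i bv) -mu_coord_setU // => [|t [_ [/= t0 _]] [_ [/= _ t1]]].
    congr (mu (coord_set v _)); apply/seteqP; split => t /=.
      move=> [h [/= t0 t1]]; have [tp|tn] := ltP 0 (t i); [left|right]; split => //.
    by move=> [[h [/= t0 t1]]|[h [/= t0 t1]]]; split => //; split => /=; lra.
  by lra.
rewrite -faces -mu_coord_setU // => [|t [_ [/= _ t0]] [_ [/= t1 _]]]; last by lra.
pose J := slab i ([set t | 0 < t i] `&` [set t : 'I_n -> R | t i <= 1]).
pose J' := slab i ([set t | -1 < t i] `&` [set t : 'I_n -> R | t i <= 0]).
have mJ' : measurable (coord_set v J' : set (borelV dot)).
  by apply: (measurable_slab oe be); apply: measurable_coord_setI;
    [exact: (measurable_coord_gt oe be)|exact: (measurable_coord_le oe be)].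
(* The interval [(0, 1]] is [(-1, 0]] shifted by 1, and [(-1, 0]] is [[0, 1)] with its sign
   changed. *)
have -> : I `|` S 1 1 = [set t | J' (fun k => t k - s k)].
  apply/seteqP; split => t /=.
    move=> ht; split => [k ki|/=].
      by rewrite sN // subr0; case: ht => -[+ _]; apply.
    by case: ht => -[_ [/= t0 t1]]; split => /=; rewrite sI; lra.
  move=> [h [/= t0 t1]]; have h' k : k != i -> 0 <= t k < 1.
    by move=> ki; have := h k ki; rewrite sN // subr0.
  move: t0 t1; rewrite sI => t0 t1.
  by have [tp|tn] := ltP (t i) 1; [left|right]; split => //; split => /=; lra.
rewrite (mu_coord_shift bv mu_trans s mJ') (parallelepiped_slab i bw); congr (mu _).
apply/funext => x; rewrite /coord_set /=.
rewrite (@coordsE v _ (fun k => if k == i then - coords v x k else coords v x k) x) //.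
  apply/propext; split => -[h [/= t0 t1]]; split => [k ki|].
  - by have := h k ki; rewrite (negPf ki).
  - by move: t0 t1; rewrite /= eqxx => t0 t1; split => /=; lra.
  - by rewrite (negPf ki); apply: h.
  - by move: t0 t1 => /= t0 t1; rewrite eqxx; split => /=; lra.
apply: eq_bigr => k _; rewrite dfwithE; case: eqP => // ->.
by rewrite scalerN scaleNr opprK.
Qed.

Lemma vol_tperm v i j : vol (v \o tperm i j) = vol v.
Proof.
congr (mu _); apply/seteqP; split => x [t t01 ->].
  exists (t \o tperm i j) => [k|]; first exact: t01.
  by rewrite [RHS](reindex_perm (tperm i j)) /=; apply: eq_bigr => k _; rewrite tpermK.
exists (t \o tperm i j) => [k|]; first exact: t01.
by rewrite [LHS](reindex_perm (tperm i j)).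
Qed.

(* In the coordinates of [v] the sheared cube is [t i <= t j < 1 + t i]; its part
   [1 <= t j], translated by [- v j], fills the rest of the cube of [v]. *)
Lemma vol_add v i j : i != j -> basis_of fullv (mktuple v) ->
  basis_of fullv (mktuple (upd v i (v i + v j))) ->
  vol (upd v i (v i + v j)) = vol v.
Proof.
move=> ij bv bw.
(* [A] is the common part of the two cubes and [B] the rest of the cube of [v]. The inequality
   [t i <= t j] is written as a complement to reuse the measurability of the strict one. *)
pose A := slab j (~` [set t | t j < t i] `&` [set t : 'I_n -> R | t j < 1]).
pose B := slab j ([set t | 0 <= t j] `&` [set t : 'I_n -> R | t j < t i]).
have mA : measurable (coord_set v A : set (borelV dot)).
  apply: (measurable_slab oe be); apply: measurable_coord_setI.
    by apply: measurable_coord_setC; exact: (measurable_coord_ltc oe be).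
  exact: (measurable_coord_lt oe be).
have mB : measurable (coord_set v B : set (borelV dot)).
  by apply: (measurable_slab oe be); apply: measurable_coord_setI;
    [exact: (measurable_coord_ge oe be)|exact: (measurable_coord_ltc oe be)].
have -> : vol v = (mu (coord_set v A) + mu (coord_set v B))%E.
  rewrite (parallelepiped_slab j bv) -mu_coord_setU // => [|t [_ [/= t0 _]] [_ [/= _ t1]]] //.
  congr (mu (coord_set v _)); apply/seteqP; split => t /=.
    move=> [h [/= t0 t1]]; have [tp|tn] := ltP (t j) (t i); [right|left]; split => //.
    by split => //=; apply/negP; rewrite -leNgt.
  have h' : (forall k, k != j -> 0 <= t k < 1) -> 0 <= t i < 1 by apply.
  move=> [[h [/= /negP]]|[h [/= t0 t1]]]; have := h' h.
    by rewrite -leNgt => ti tij tj; split => //; split => /=; lra.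
  by move=> ti; split => //; split => /=; lra.
pose s k : R := if k == j then 1 else 0.
have sI : s j = 1 by rewrite /s eqxx.
have sN k : k != j -> s k = 0 by rewrite /s => /negPf ->.
pose C := slab j ([set t | 1 <= t j] `&` [set t : 'I_n -> R | t j < 1 + t i]).
have CE : C = [set t | B (fun k => t k - s k)].
  apply/seteqP; split => t /= -[h [/= t0 t1]]; split => [k kj|/=].
  - by rewrite sN // subr0; apply: h.
  - by split => /=; rewrite sI ?(sN i) //; lra.
  - by have := h k kj; rewrite sN // subr0.
  - by move: t0 t1; rewrite sI (sN i) // => t0 t1; split => /=; lra.
rewrite -(mu_coord_shift bv mu_trans s mB) -CE.
have mC : measurable (coord_set v C : set (borelV dot)).
  have -> : C = slab j ([set t | 1 <= t j] `&` ~` [set t : 'I_n -> R | 1 + t i <= t j]).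
    apply/seteqP; split => t /= -[h [/= t0 t1]]; split => //; split => //=.
      by apply/negP; rewrite -ltNge.
    by move/negP: t1; rewrite -ltNge.
  apply: (measurable_slab oe be); apply: measurable_coord_setI.
    exact: (measurable_coord_ge oe be).
  apply: measurable_coord_setC.
  have -> : coord_set v [set t | 1 + t i <= t j] =
      ~` [set x | (coord (mktuple v) j \- coord (mktuple v) i : {scalar V}) x < 1].
    apply/seteqP; split => x; rewrite /coord_set /coords /= ltrBlDr leNgt => /negP //.
  by apply: measurableC; apply: (halfspace_measurable oe be).
rewrite -mu_coord_setU // => [|t [_ [/= _ t1]] [_ [/= t2 _]]]; last by lra.
rewrite (parallelepiped_slab j bw); congr (mu _); apply/funext => x.
rewrite /coord_set /=.
rewrite (@coordsE v _ (fun k => if k == j then coords v x j - coords v x i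
  else coords v x k) x) //.
  set t := coords v x.
  have h' : (forall k, k != j -> 0 <= t k < 1) -> 0 <= t i < 1 by apply.
  apply/propext; split.
    move=> [h]; rewrite /= eqxx => -[/= t0 t1].
    have hk k : k != j -> 0 <= t k < 1 by move=> kj; have := h k kj; rewrite (negPf kj).
    have := h' hk; have [tp|tn] := ltP (t j) 1; [left|right]; split => //; split => //=.
    - by apply/negP; rewrite -leNgt; lra.
    - by lra.
  have key : (forall k, k != j -> 0 <= t k < 1) -> t i <= t j < 1 + t i ->
      slab j ([set t | 0 <= t j] `&` [set t | t j < 1])
        (fun k => if k == j then t j - t i else t k).
    move=> h tij; split => [k kj|]; first by rewrite (negPf kj); apply: h.
    by split; rewrite /= eqxx; lra.
  move=> [[h [/= /negP]]|[h [/= t1 t2]]]; have := h' h.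
    by rewrite -leNgt => ti tj t1; apply: key => //; lra.
  by move=> ti; apply: key => //; lra.
rewrite (bigD1 j) //= [RHS](bigD1 j) //= eqxx dfwithout //.
rewrite (bigD1 i) //= [in RHS](bigD1 i) //= dfwithin (negPf ij).
rewrite (eq_bigr (fun k => (if k == j then coords v x j - coords v x i
  else coords v x k) *: upd v i (v i + v j) k)) => [|k /andP[kj ki]]; last first.
  by rewrite (negPf kj) dfwithout // eq_sym.
by rewrite scalerDr scalerBl [X in _ = _ + (X + _)]addrC -!addrA addKr.
Qed.

End VolumeSteps.

(** * The exchange argument *)

Section VolumeIsDeterminant.
Context {R : realType} {V : vectType R} (dot : {dot V for idfun}).
Context (n : nat) (e : 'I_n -> V).
Hypotheses (oe : orthonormal_fam dot e) (be : basis_of fullv (mktuple e)).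
Variable (mu : {measure set (borelV dot) -> \bar R}).
Hypothesis mu_trans : translation_invariant dot mu.
Local Notation D v := (\det (dot_mx dot e v)).
Local Notation upd v i x := (@dfwith _ (fun=> V) v i x).
Local Notation vol v := (mu (parallelepiped v)).
Implicit Types (v w : 'I_n -> V).

(** The basis property travels with the formula, since each volume step requires both its source and
    its target to be bases. *)
Definition vol_det v := basis_of fullv (mktuple v) /\ vol v = (`|D v|)%:E.

Lemma dfwith_twice v i x y : upd (upd v i x) i y = upd v i y.
Proof. by apply/funext => k; rewrite !dfwithE; case: eqP. Qed.

Lemma vol_det_scale_pos v i c : 0 < c -> vol_det v -> vol_det (upd v i (c *: v i)).
Proof.
move=> c0 [bv vv].
have bw : basis_of fullv (mktuple (upd v i (c *: v i))).
  by rewrite -(det_dot_mx_neq0 _ oe be) det_dot_mxZ mulf_neq0 ?(gt_eqF c0) //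
    (det_dot_mx_neq0 _ oe be).
split=> //; rewrite (vol_scale_pos oe be mu_trans bv c0 bw vv).
by rewrite det_dot_mxZ normrM gtr0_norm.
Qed.

Lemma vol_det_opp v i : vol_det v -> vol_det (upd v i (- v i)).
Proof.
move=> [bv vv]; have DN : D (upd v i (- v i)) = - D v.
  by rewrite -scaleN1r det_dot_mxZ mulN1r.
have bw : basis_of fullv (mktuple (upd v i (- v i))).
  by rewrite -(det_dot_mx_neq0 _ oe be) DN oppr_eq0 (det_dot_mx_neq0 _ oe be).
by split=> //; rewrite (vol_opp oe be mu_trans bv bw) DN normrN.
Qed.

Lemma vol_det_scale v i c : c != 0 -> vol_det v -> vol_det (upd v i (c *: v i)).
Proof.
move=> c0 vv; have [cn|cp|c00] := ltgtP c 0; last by rewrite c00 eqxx in c0.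
  have /(vol_det_opp i) : vol_det (upd v i (- c *: v i)).
    by apply: vol_det_scale_pos; rewrite ?oppr_gt0.
  by rewrite dfwith_twice dfwithin scaleNr opprK.
exact: vol_det_scale_pos.
Qed.

Lemma vol_det_add v i j : i != j -> vol_det v -> vol_det (upd v i (v i + v j)).
Proof.
move=> ij [bv vv].
have bw : basis_of fullv (mktuple (upd v i (v i + v j))).
  by rewrite -(det_dot_mx_neq0 _ oe be) det_dot_mx_add // (det_dot_mx_neq0 _ oe be).
by split=> //; rewrite (vol_add oe be mu_trans ij bv bw) det_dot_mx_add.
Qed.

Lemma vol_det_tperm v i j : vol_det v -> vol_det (v \o tperm i j).
Proof.
have [<- //|ij [bv vv]] := eqVneq i j.
  by rewrite (_ : v \o tperm i i = v) //; apply/funext => k /=; rewrite tperm1 perm1.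
have DN : D (v \o tperm i j) = - D v by exact: det_dot_mx_alternating.
split; last by rewrite vol_tperm vv DN normrN.
by rewrite -(det_dot_mx_neq0 _ oe be) DN oppr_eq0 (det_dot_mx_neq0 _ oe be).
Qed.

(** For [c != 0]: scale [v j] by [c], add it to [v i], and scale it back. *)
Lemma vol_det_addZ v i j c : i != j -> vol_det v -> vol_det (upd v i (v i + c *: v j)).
Proof.
move=> ij vv; have [->|c0] := eqVneq c 0.
  rewrite scale0r addr0 (_ : upd v i (v i) = v) //.
  by apply/funext => k; rewrite dfwithE; case: eqP => [->|].
have c0' : c^-1 != 0 by rewrite invr_eq0.
have := vol_det_scale j c0' (vol_det_add ij (vol_det_scale j c0 vv)).
congr vol_det; apply/funext => k; rewrite !dfwithE eqxx (negPf ij) [j == i]eq_sym (negPf ij).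
have [->|ki] := eqVneq k i; first by rewrite (negPf ij).
by have [->|//] := eqVneq k j; rewrite scalerA mulVf // scale1r.
Qed.

Lemma vol_det_add_sum v i (c : 'I_n -> R) (s : seq 'I_n) : i \notin s ->
  vol_det v -> vol_det (upd v i (v i + \sum_(k <- s) c k *: v k)).
Proof.
move=> + vv; elim: s => [|j s IHs].
  rewrite big_nil addr0 (_ : upd v i (v i) = v) //.
  by apply/funext => k; rewrite dfwithE; case: eqP => [->|].
rewrite inE negb_or => /andP[ij /IHs/(vol_det_addZ (c j) ij)].
rewrite dfwith_twice dfwithin dfwithout // big_cons -addrA.
by rewrite [X in _ -> vol_det (upd v i (_ + X))]addrC.
Qed.

Lemma vol_det_replace v i (c : 'I_n -> R) : c i != 0 ->
  vol_det v -> vol_det (upd v i (\sum_k c k *: v k)).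
Proof.
move=> ci vv; set s := [seq k <- index_enum 'I_n | k != i].
have := @vol_det_add_sum _ i c s _ (vol_det_scale i ci vv).
rewrite mem_filter eqxx => /(_ isT); congr vol_det.
rewrite dfwith_twice dfwithin (bigD1 i) //= big_filter; congr (upd v i (_ + _)).
by apply: eq_bigr => k ki; rewrite dfwithout // eq_sym.
Qed.

(* Steinitz exchange: the vectors of [e] are replaced one at a time by those
   of [v], and each exchange preserves [vol_det]. *)
Lemma vol_det_basis v : vol_det e -> basis_of fullv (mktuple v) -> vol_det v.
Proof.
move=> ve bv; have [m] := ubnP #|[set k | e k != v k]%SET|.
(* Induction on the number of positions where the current family [w] differs from [v]. *)
move: e ve => w; elim: m w => // m IHm w ww; rewrite ltnS => wm.
have [/forallP wv|] := boolP [forall k, w k == v k].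
  by rewrite (_ : v = w) //; apply/funext => k; apply/esym/eqP.
rewrite negb_forall => /existsP[i wvi].
pose c := coords w (v i).
have vi : v i = \sum_k c k *: w k by rewrite sum_coords //; case: ww.
(* Otherwise [v i] would be a combination of those [w k] that equal [v k], all with [k != i],
   against the freeness of [v]. *)
have [j wvj cj] : exists2 j, w j != v j & c j != 0.
  have [/existsP[j /andP[]]|] := boolP [exists j, (w j != v j) && (c j != 0)].
    by exists j.
  rewrite negb_exists => /forallP c0; exfalso.
  have /freeP/(_ (fun k => (k == i)%:R - (if w k == v k then c k else 0))) := basis_free bv.
  move=> /(_ _ i); rewrite eqxx (negPf wvi) subr0 => h.
  have /eqP := oner_neq0 R; apply; apply: h.
  under eq_bigr => k _ do rewrite -tnth_nth tnth_mktuple scalerBl.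
  rewrite sumrB (bigD1 i) //= eqxx scale1r big1 => [|k /negPf ->]; last by rewrite scale0r.
  rewrite addr0 {1}vi -sumrB big1 // => k _.
  have := c0 k; rewrite negb_and negbK; case: eqP => [->|_ /=]; first by rewrite subrr.
  by rewrite negbK => /eqP ->; rewrite !scale0r subrr.
(* [v i] enters at position [j], where its coefficient is nonzero, and the swap moves it to its own
   position [i]. Position [j] was a disagreement already, so whatever lands there does no harm. *)
apply: (IHm (upd w j (v i) \o tperm i j)).
  by apply: vol_det_tperm; rewrite vi; apply: vol_det_replace.
apply: leq_trans wm; apply: proper_card; apply/properP; split; last first.
  by exists i; rewrite ?inE // /= tpermL dfwithin eqxx.
apply/fintype.subsetP => k; rewrite !inE /=; case: tpermP => [->|-> _|ki kj];
  rewrite ?dfwithin ?eqxx //.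
by rewrite dfwithout //; apply/eqP => /esym.
Qed.

End VolumeIsDeterminant.

Theorem proposition4p1 (R : realType) (V : vectType R)
    (dot : {dot V for idfun}) (n : nat) (n_ge1 : (1 <= n)%N)
    (e : 'I_n -> V) (e_onb : orthonormal_basis_of dot fullv e)
    (mu : {measure set (borelV dot) -> \bar R})
    (mu_trans : translation_invariant dot mu)
    (mu_unit : mu (parallelepiped e) = 1%E) :
  multilinear_map (geometric_det dot mu e) /\
  alternating_map (geometric_det dot mu e).
Proof.
case/andP: e_onb => /orthonormal_famP oe be.
suff -> : geometric_det dot mu e = fun v => \det (dot_mx dot e v).
  by split; [exact: det_dot_mx_multilinear|exact: det_dot_mx_alternating].
have vol_e : vol_det e mu e.
  by split=> //; rewrite mu_unit dot_mx_orthonormal // det1 normr1.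
apply/funext => v; rewrite /geometric_det; case: ifPn => [bv|].
  have [_ ->] := vol_det_basis oe be mu_trans vol_e bv.
  exact: orientation_det oe be (basis_free bv).
by rewrite -(det_dot_mx_neq0 _ oe be) negbK => /eqP.
Qed.
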